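(* For any nonzero ring $R$, the following are equivalent: (1) $R$ is a domain; (2) $R$ satisfies the ascending chain condition on right principal annihilators, and for every nonzero completely prime right ideal $P$ of $R$, $P$ is not a right principal annihilator; (3) $R$ satisfies the ascending chain condition on right principal annihilators, and every nonzero completely prime right ideal of $R$ contains a left regular element.
   Context: Rings are associative with $1$, not necessarily commutative. A right ideal $P\subsetneq R$ is completely prime if for all $a,b\in R$ with $aP\subseteq P$, $ab\in P$ implies $a\in P$ or $b\in P$. A right principal annihilator in $R$ is a right ideal of the form $\{r\in R: xr=0\}$ for some $x\in R\setminus\{0\}$. An element $s\in R$ is left regular if its left annihilator $\{r\in R: rs=0\}$ is $0$. A (not necessarily commutative) nonzero ring is a domain if it has no nonzero elements $a,b$ with $ab=0$. *)

(* Defs.v *)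
From HB Require Import structures.
From mathcomp Require Import all_boot all_algebra.
From mathcomp Require Import classical_sets.

Set Implicit Arguments.
Unset Strict Implicit.
Unset Printing Implicit Defensive.

Import GRing.Theory.
Local Open Scope classical_set_scope.
Local Open Scope ring_scope.

(* Ideals and annihilators are Prop-valued subsets [set R], since membership in
   a right ideal of an arbitrary ring need not be decidable. *)

(* The type [nzRingType] already carries 1 != 0. *)
Definition is_domain (R : nzRingType) : Prop :=
  ~ exists a b : R, [/\ a <> 0, b <> 0 & a * b = 0].

Record right_ideal (R : nzRingType) (P : set R) : Prop := RightIdeal {
  right_ideal0 : P 0;
  right_idealB : forall a b, P a -> P b -> P (a - b);
  right_idealM : forall a r, P a -> P (a * r)
}.

Record completely_prime_right_ideal (R : nzRingType) (P : set R) : Prop :=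
  CompletelyPrimeRightIdeal {
    cprime_right_ideal : right_ideal P;
    cprime_proper : P <> setT;
    cprime_prime : forall a b : R,
      [set a * p | p in P] `<=` P -> P (a * b) -> P a \/ P b
  }.

Definition right_annihilator (R : nzRingType) (x : R) : set R :=
  [set r | x * r = 0].

Definition left_annihilator (R : nzRingType) (s : R) : set R :=
  [set r | r * s = 0].

Definition right_principal_annihilator (R : nzRingType) (I : set R) : Prop :=
  exists2 x : R, x <> 0 & I = right_annihilator x.

(* In MathComp's convention ([GRing.lreg], [GRing.rreg]), the side is that of
   the multiplication required to be injective, so this is [GRing.rreg s]. *)
Definition left_regular (R : nzRingType) (s : R) : Prop :=
  left_annihilator s = [set 0].

Definition acc_right_principal_annihilators (R : nzRingType) : Prop :=
  forall I : nat -> set R,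
    (forall n, right_principal_annihilator (I n)) ->
    (forall n, I n `<=` I n.+1) ->
    exists N, forall n, (N <= n)%N -> I n = I N.

(* Main.v *)
Require Import Defs.
From HB Require Import structures.
From mathcomp Require Import all_boot all_algebra.
From mathcomp Require Import boolp classical_sets.

Set Implicit Arguments.
Unset Strict Implicit.

Import GRing.Theory.
Local Open Scope classical_set_scope.
Local Open Scope ring_scope.

(** In a ring with zero divisors, some annihilator [ann x] with [x <> 0] is
    nonzero; under the ascending chain condition it lies below a maximal one,
    [P = ann z] ([acc_maximal_annihilator]).  Maximal right principal
    annihilators are completely prime ([maximal_annihilator_cprime]): if
    [a P] is inside [P] and [z * a <> 0], then [ann (z * a)] contains [P], hence
    equals [P].  So under the chain condition a ring that is not a domain has a
    nonzero completely prime right principal annihilator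
    ([acc_domain_or_cprime_annihilator]).  The second condition forbids this outright,
    and the third excludes it because a left regular [s] in [ann z] would
    force [z = 0].  In a domain, conversely, every right principal annihilator
    is zero and every nonzero element is left regular. *)

Lemma right_ideal_annihilator (R : nzRingType) (x : R) :
  right_ideal (right_annihilator x).
Proof.
split; rewrite /right_annihilator /=; first by rewrite mulr0.
- by move=> a b xa xb; rewrite mulrBr xa xb subrr.
- by move=> a r xa; rewrite mulrA xa mul0r.
Qed.

Lemma right_ideal_neq0 (R : nzRingType) (P : set R) :
  right_ideal P -> P <> [set 0] -> exists2 s, P s & s <> 0.
Proof.
move=> idP P0; apply: contrapT => noS; apply: P0; apply/seteqP; split.
- by move=> s Ps /=; apply: contrapT => s0; apply: noS; exists s.
- by move=> s ->; apply: right_ideal0 idP.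
Qed.

Lemma domain_mul_eq0 (R : nzRingType) (a b : R) :
  is_domain R -> a * b = 0 -> a <> 0 -> b = 0.
Proof.
by move=> domR ab a0; apply: contrapT => b0; apply: domR; exists a, b.
Qed.

Lemma domain_annihilator (R : nzRingType) (I : set R) :
  is_domain R -> right_principal_annihilator I -> I = [set 0].
Proof.
move=> domR [x x0 ->]; apply/seteqP; split=> r /=.
- by move=> xr; apply: domain_mul_eq0 xr x0.
- by move=> ->; apply: mulr0.
Qed.

Lemma domain_acc (R : nzRingType) :
  is_domain R -> acc_right_principal_annihilators R.
Proof.
move=> domR I annI _; exists 0%N => n _.
by rewrite (domain_annihilator domR (annI n)) (domain_annihilator domR (annI 0%N)).
Qed.

Lemma domain_left_regular (R : nzRingType) (s : R) :
  is_domain R -> s <> 0 -> left_regular s.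
Proof.
move=> domR s0; apply/seteqP; split=> r /=.
- move=> rs; apply: contrapT => r0.
  exact/s0/(domain_mul_eq0 domR rs r0).
- by move=> ->; apply: mul0r.
Qed.

(** Otherwise a function [f] choosing a generator of a strictly larger
    annihilator could be iterated from [x] into a chain that never becomes
    stationary. *)
Lemma acc_maximal_annihilator (R : nzRingType) (x : R) :
  acc_right_principal_annihilators R -> x <> 0 ->
  exists z : R, [/\ z <> 0, right_annihilator x `<=` right_annihilator z &
    forall y : R, y <> 0 -> right_annihilator z `<=` right_annihilator y ->
      right_annihilator y = right_annihilator z].
Proof.
move=> acc x0; apply: contrapT => noMax.
pose above z := z <> 0 /\ right_annihilator x `<=` right_annihilator z.
have /choice[f fP] (z : R) : exists y, above z ->
    [/\ above y, right_annihilator z `<=` right_annihilator y &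
        right_annihilator y <> right_annihilator z].
  apply: contrapT => noY; apply: noMax; exists z.
  have [z0 xz] : above z.
    by apply: contrapT => nz; apply: noY; exists 0 => /nz.
  split=> // y y0 zy; apply: contrapT => neq; apply: noY.
  by exists y => _; split=> //; split=> //; apply: subset_trans zy.
have aboveI n : above (iter n f x).
  by elim: n => [|n /fP[]] //; split.
have [n|n|N /(_ N.+1 (leqnSn N))] := acc (fun n => right_annihilator (iter n f x)).
- by exists (iter n f x); first by have [] := aboveI n.
- by have [] := fP _ (aboveI n).
- by have [_ _] := fP _ (aboveI N).
Qed.

Lemma maximal_annihilator_cprime (R : nzRingType) (z : R) : z <> 0 ->
  (forall y : R, y <> 0 -> right_annihilator z `<=` right_annihilator y ->
     right_annihilator y = right_annihilator z) ->
  completely_prime_right_ideal (right_annihilator z).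
Proof.
move=> z0 maxz; split; first exact: right_ideal_annihilator.
- move=> annT; apply: z0; rewrite -[z]mulr1.
  by have : right_annihilator z 1 by rewrite annT.
- move=> a b aP zab; have [za|za] := pselect (z * a = 0); [by left|right].
  rewrite -(maxz _ za); first by rewrite /right_annihilator /= -mulrA.
  by move=> p zp; rewrite /right_annihilator /= -mulrA; apply: aP; exists p.
Qed.

Lemma acc_domain_or_cprime_annihilator (R : nzRingType) :
  acc_right_principal_annihilators R ->
  is_domain R \/ exists P : set R, [/\ completely_prime_right_ideal P,
    P <> [set 0] & right_principal_annihilator P].
Proof.
move=> acc; have [domR|/contrapT[a [b [a0 b0 ab]]]] := pselect (is_domain R).
  by left.
right; have [z [z0 az maxz]] := acc_maximal_annihilator acc a0.
exists (right_annihilator z); split; last by exists z.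
- exact: maximal_annihilator_cprime.
- by move=> ann0; apply: b0; have := az b ab; rewrite ann0.
Qed.

Theorem proposition5p5 (R : nzRingType) :
  [<-> is_domain R;
       acc_right_principal_annihilators R /\
       (forall P : set R, completely_prime_right_ideal P -> P <> [set 0] ->
          ~ right_principal_annihilator P);
       acc_right_principal_annihilators R /\
       (forall P : set R, completely_prime_right_ideal P -> P <> [set 0] ->
          exists2 s : R, P s & left_regular s)].
Proof.
tfae.
- move=> domR; split; first exact: domain_acc.
  by move=> P _ P0 /(domain_annihilator domR).
- move=> [acc noAnn]; split=> // P cpP P0.
  (* The second condition gives the third only by way of the first. *)
  have domR : is_domain R.
    have [//|[Q [cpQ Q0 annQ]]] := acc_domain_or_cprime_annihilator acc.
    by case: (noAnn Q cpQ Q0 annQ).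
  have [s Ps s0] := right_ideal_neq0 (cprime_right_ideal cpP) P0.
  by exists s => //; apply: domain_left_regular.
- move=> [acc regP].
  have [//|[P [cpP P0 [z z0 Pz]]]] := acc_domain_or_cprime_annihilator acc.
  have [s Ps regs] := regP P cpP P0; case: z0.
  have : left_annihilator s z by move: Ps; rewrite Pz.
  by rewrite regs.
Qed.
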